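(* Let $S[1..n]$ be a string over $\Sigma=\{1,\dots,\sigma\}$ and let $L[1..n]$ be its Burrows--Wheeler transform. Let $\mathcal{T}$ be a VLB-tree built on $L$ with block size $\ell$, branching factor $f$ and run threshold $w$, where $\ell=f^{x}$ and $w=f^{y}$ for integers $x>y$. Then, for every position $i\in[1..n]$, the query $access(L,i)$ (returning $L[i]$) can be answered on $\mathcal{T}$ in $O(\log_f(\ell/w)+w)$ time.
   Context: Model: word RAM; $f\le 64$, so that rank/predecessor/select on bitvectors of length at most $f$ (and on the per-node alphabet bitvectors, assumed to fit in a machine word) take constant time with word operations. $rle(X)$ denotes the run-length encoding of a sequence $X$ as a list of (symbol, length) pairs of maximal equal-symbol runs. For a bitvector $B$, $rank_1(B,i)$ is the number of 1s in $B[1..i]$, $select_1(B,j)$ is the position of the $j$-th 1, $pred_1(B,i)$ is the largest position $\le i$ holding a 1. VLB-tree construction. Split $L$ into $\lceil n/\ell\rceil$ blocks of length $\ell$, processed left to right. If a block has at most $w$ runs, it is greedily concatenated with the following blocks as long as the concatenation has at most $w$ runs; the maximal concatenation becomes a leaf child of the root (a ''superblock''). If a block has more than $w$ runs it becomes an internal node, whose fragment is split into $f$ equal-length parts of length $|fragment|/f$, which are processed recursively left to right with the same merge-or-split rule (consecutive parts of the same parent with at most $w$ runs in total merge into one leaf; parts with more than $w$ runs become internal nodes). For a node $u$ with fragment $L^u$ and parent $v$ with fragment $L^v$ over alphabet $\Sigma^v=[1..\sigma^v]$, the symbols of $L^u$ are renamed to a compact alphabet $[1..\sigma^u]$; node $u$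 stores a bitvector $A[1..\sigma^v]$ with $A[c]=1$ iff parent symbol $c$ occurs in $L^u$ (so compact symbol $c'$ corresponds to parent symbol $select_1(A,c')$). A leaf stores the array $E=rle$ of its (compacted) fragment, with at most $w$ runs. An internal node stores a bitvector $X[1..f]$ marking which of its $f$ parts begin a child, and an array $P$ of child pointers; the root stores, for each top-level block $b$, either a pointer to the child starting at block $b$ or the offset to the block where the child covering $b$ starts. $access(L,i)$: compute the top-level block $b=\lceil i/\ell\rceil$, find the root child covering it and the local offset of $i$; at each internal node with part length $\ell_u$, compute $b=\lceil i/\ell_u\rceil$, $o=pred_1(X,b)$, $q=rank_1(X,o)$, set $i\gets i-(o-1)\ell_u$ and go to the $q$-th child; at the leaf, scan $E$ to find the run containing local position $i$, obtaining a compacted symbol; then ascend the visited path applying $c\gets select_1(A,c)$ at each node to recover the original symbol. *)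

(* Defs.v *)
(* MathComp *)
From mathcomp Require Import all_boot all_order.

Set Implicit Arguments.
Unset Strict Implicit.
Unset Printing Implicit Defensive.

(** * Strings and bitvectors

    Positions are 1-based: [at1 s i] is s[i]. *)

Definition at1 (s : seq nat) (i : nat) : nat := nth 0 s i.-1.

(* Last column of the matrix of lexicographically sorted rotations.  Equal
   rotations have the same last symbol, so the order of ties is irrelevant. *)
Definition bwt (s : seq nat) : seq nat :=
  [seq last 0 r | r <- sort (fun u v : seqlexi nat => (u <= v)%O)
                            [seq rot k s | k <- iota 0 (size s)]].

Fixpoint rle (s : seq nat) : seq (nat * nat) :=
  if s is c :: s' then
    if rle s' is (d, k) :: r then
      if c == d then (d, k.+1) :: r else (c, 1) :: (d, k) :: r
    else [:: (c, 1)]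
  else [::].

Definition nruns (s : seq nat) : nat := size (rle s).

Definition ones (B : bitseq) : seq nat :=
  [seq p <- iota 1 (size B) | nth false B p.-1].

Definition rank1 (B : bitseq) (i : nat) : nat := count id (take i B).
Definition select1 (B : bitseq) (j : nat) : nat := nth 0 (ones B) j.-1.
(* 0 if there is no 1 in B[1..i]. *)
Definition pred1 (B : bitseq) (i : nat) : nat :=
  last 0 [seq p <- ones B | p <= i].

(** * VLB-trees *)

Inductive vlb_node : Type :=
| Leaf (A : bitseq) (E : seq (nat * nat))
| Inner (A X : bitseq) (P : seq vlb_node).

Inductive root_entry : Type :=
| Child (u : vlb_node)
| Offset (d : nat).

Record vlb_tree : Type := VlbTree {
  block_size : nat;
  branching : nat;
  top_blocks : seq root_entry
}.

(* ceil(|g| / len) consecutive parts, all of length len except possibly the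
   last one, which may be shorter. *)
Definition parts (len : nat) (g : seq nat) : seq (seq nat) :=
  reshape (nseq ((size g + len.-1) %/ len) len) g.

(* Greedy merging, left to right.  [cur] is the concatenation of the [k]
   latest parts; each group is returned with its number of parts.  A part
   with more than w runs is never merged with a neighbour, since appending
   symbols does not decrease the number of runs. *)
Fixpoint merge_parts (w k : nat) (cur : seq nat) (ps : seq (seq nat)) :
    seq (nat * seq nat) :=
  if ps is p :: ps' then
    if nruns (cur ++ p) <= w then merge_parts w k.+1 (cur ++ p) ps'
    else (k, cur) :: merge_parts w 1 p ps'
  else [:: (k, cur)].

Definition groups (w : nat) (ps : seq (seq nat)) : seq (nat * seq nat) :=
  if ps is p :: ps' then merge_parts w 1 p ps' else [::].

Definition alphabet_bits (sigma : nat) (g : seq nat) : bitseq :=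
  [seq c \in g | c <- iota 1 sigma].

Definition compact (A : bitseq) (g : seq nat) : seq nat :=
  [seq rank1 A c | c <- g].

Definition start_bits (f : nat) (gs : seq (nat * seq nat)) : bitseq :=
  let B := flatten [seq true :: nseq g.1.-1 false | g <- gs] in
  B ++ nseq (f - size B) false.

(* The node of a fragment g, written over the parent alphabet [1..sigma].
   A fragment with more than w runs always is a single part of its parent;
   its nominal length is f ^ k, and it is shorter only when it contains the
   end of L.  It is cut into parts of length f ^ k / f.  For k = 0 there is
   at most one symbol, hence at most w runs. *)
Fixpoint build_node (f w k sigma : nat) (g : seq nat) : vlb_node :=
  let A := alphabet_bits sigma g in
  let h := compact A g in
  if k is k'.+1 then
    if nruns g <= w then Leaf A (rle h)
    else let gs := groups w (parts (f ^ k') h) in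
         Inner A (start_bits f gs)
               [seq build_node f w k' (count id A) p.2 | p <- gs]
  else Leaf A (rle h).

(* Block size f ^ x, branching factor f and run threshold w.  The entry of a
   block that does not start a child is its distance to the block that does. *)
Definition build_vlb_tree (f x w sigma : nat) (L : seq nat) : vlb_tree :=
  VlbTree (f ^ x) f
    (flatten [seq Child (build_node f w x sigma p.2)
                    :: [seq Offset d | d <- iota 1 p.1.-1]
             | p <- groups w (parts (f ^ x) L)]).

(** * Word RAM with words of W bits

    Programs are structured.  There are finitely many registers per program,
    a read-only memory that holds the data structure, and a work memory.
    Every operation costs one unit, including rank, select and predecessor on
    a bitvector held in a word. *)

Definition word_of (B : bitseq) : nat := foldr (fun (b : bool) v => b + v.*2) 0 B.

Definition bits_of (W v : nat) : bitseq := mkseq (fun j => odd (v %/ 2 ^ j)) W.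

Inductive binop : Type :=
| OAdd | OSub | OMul | ODiv | OLt | OEq | ORank | OSelect | OPred.

(* Arithmetic is modulo 2 ^ W. *)
Definition eval_binop (W : nat) (o : binop) (u v : nat) : nat :=
  match o with
  | OAdd => (u + v) %% 2 ^ W
  | OSub => (u + (2 ^ W - v)) %% 2 ^ W
  | OMul => (u * v) %% 2 ^ W
  | ODiv => u %/ v
  | OLt => u < v
  | OEq => u == v
  | ORank => rank1 (bits_of W u) v
  | OSelect => select1 (bits_of W u) v
  | OPred => pred1 (bits_of W u) v
  end.

Inductive expr : Type :=
| Const (c : nat)
| Reg (r : nat)
| DataAt (e : expr)
| WorkAt (e : expr)
| Op (o : binop) (e1 e2 : expr).

Inductive cmd : Type :=
| Skip
| Assign (r : nat) (e : expr)
| Write (e1 e2 : expr)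
| Seq (c1 c2 : cmd)
| If (e : expr) (c1 c2 : cmd)
| While (e : expr) (c : cmd).

Record state : Type := State { reg : nat -> nat; work : nat -> nat }.

Definition update (h : nat -> nat) (a v : nat) : nat -> nat :=
  fun b => if b == a then v else h b.

Fixpoint eval (W : nat) (m : seq nat) (s : state) (e : expr) : nat :=
  match e with
  | Const c => c %% 2 ^ W
  | Reg r => reg s r
  | DataAt e' => nth 0 m (eval W m s e')
  | WorkAt e' => work s (eval W m s e')
  | Op o e1 e2 => eval_binop W o (eval W m s e1) (eval W m s e2)
  end.

Fixpoint cost (e : expr) : nat :=
  match e with
  | Const _ | Reg _ => 1
  | DataAt e' | WorkAt e' => (cost e').+1
  | Op _ e1 e2 => (cost e1 + cost e2).+1
  end.

(* [exec W m c s s' t]: started in s, the program c halts in s' after t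
   units of time. *)
Inductive exec (W : nat) (m : seq nat) :
    cmd -> state -> state -> nat -> Prop :=
| ExecSkip s : exec W m Skip s s 1
| ExecAssign r e s :
    exec W m (Assign r e) s
      (State (update (reg s) r (eval W m s e)) (work s)) (cost e).+1
| ExecWrite e1 e2 s :
    exec W m (Write e1 e2) s
      (State (reg s) (update (work s) (eval W m s e1) (eval W m s e2)))
      (cost e1 + cost e2).+1
| ExecSeq c1 c2 s s1 s2 t1 t2 :
    exec W m c1 s s1 t1 -> exec W m c2 s1 s2 t2 ->
    exec W m (Seq c1 c2) s s2 (t1 + t2).+1
| ExecIfTrue e c1 c2 s s1 t :
    eval W m s e != 0 -> exec W m c1 s s1 t ->
    exec W m (If e c1 c2) s s1 (cost e + t).+1
| ExecIfFalse e c1 c2 s s1 t :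
    eval W m s e = 0 -> exec W m c2 s s1 t ->
    exec W m (If e c1 c2) s s1 (cost e + t).+1
| ExecWhileTrue e c s s1 s2 t1 t2 :
    eval W m s e != 0 -> exec W m c s s1 t1 ->
    exec W m (While e c) s1 s2 t2 ->
    exec W m (While e c) s s2 (cost e + t1 + t2).+1
| ExecWhileFalse e c s :
    eval W m s e = 0 -> exec W m (While e c) s s (cost e).+1.

(* A query receives the address of the data structure in register 0 and its
   argument in register 1; the answer is returned in register 0. *)
Definition init_state (a i : nat) : state :=
  State (nth 0 [:: a; i]) (fun=> 0).

Definition answer (s : state) : nat := reg s 0.

(** * Memory representation of a VLB-tree

    A bitvector occupies one word, and the length of E and the entries of E,
    of P and of the table of top-level blocks are stored inline. *)

Definition valid_memory (W : nat) (m : seq nat) : bool :=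
  (size m <= 2 ^ W) && all (fun v => v < 2 ^ W) m.

Definition stored (m : seq nat) (a : nat) (s : seq nat) : bool :=
  (a + size s <= size m) && (take (size s) (drop a m) == s).

Definition pair_cells (s : seq (nat * nat)) : seq nat :=
  flatten [seq [:: p.1; p.2] | p <- s].

Inductive node_at (m : seq nat) : nat -> vlb_node -> Prop :=
| LeafAt a A E :
    stored m a ([:: 0; word_of A; size E] ++ pair_cells E) ->
    node_at m a (Leaf A E)
| InnerAt a A X P ptrs :
    stored m a ([:: 1; word_of A; word_of X] ++ ptrs) ->
    size ptrs = size P ->
    (forall j, j < size P ->
       node_at m (nth 0 ptrs j) (nth (Leaf [::] [::]) P j)) ->
    node_at m a (Inner A X P).

Inductive entry_at (m : seq nat) : nat * nat -> root_entry -> Prop :=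
| ChildAt a u : node_at m a u -> entry_at m (1, a) (Child u)
| OffsetAt d : entry_at m (0, d) (Offset d).

Definition tree_at (m : seq nat) (a : nat) (T : vlb_tree) : Prop :=
  exists2 es : seq (nat * nat),
    stored m a ([:: block_size T; branching T] ++ pair_cells es) &
    size es = size (top_blocks T) /\
    (forall j, j < size es ->
       entry_at m (nth (0, 0) es j) (nth (Offset 0) (top_blocks T) j)).

(* Main.v *)
(* An internal node has more than w = f ^ y runs, hence more than f ^ y symbols;
   at level k its fragment has at most f ^ k symbols, so y < k <= x and at most
   x - y internal nodes lie on a path.  At each of them the bitvector X gives
   the start of the group of parts that covers the position, in constant time.
   The greedy rule puts at most w runs in a leaf, so the final scan takes O(w)
   time.  Finally select_1 on A inverts the compaction c |-> rank_1(A, c) for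
   every symbol c that occurs in the fragment.  All intermediate values are
   bounded by n, by an address of the memory or by f ^ x, which is stored in a
   word, so the arithmetic modulo 2 ^ W never wraps around. *)

Require Import Defs.
From mathcomp Require Import all_boot all_order.
From mathcomp Require Import zify.

Set Implicit Arguments.
Unset Strict Implicit.
Unset Printing Implicit Defensive.

(** * Bitvectors *)

Lemma ones_cat B1 B2 :
  ones (B1 ++ B2) = ones B1 ++ [seq size B1 + p | p <- ones B2].
Proof.
rewrite /ones size_cat iotaD filter_cat; congr (_ ++ _).
  apply: eq_in_filter => p; rewrite mem_iota /= nth_cat => /andP[p_gt0 p_le].
  by rewrite ifT //; lia.
rewrite addnC iotaDl filter_map; congr map.
apply: eq_in_filter => p; rewrite mem_iota /= nth_cat => /andP[p_gt0 _].
rewrite ifF; last by lia.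
by congr nth; lia.
Qed.

Lemma ones_cons b B :
  ones (b :: B) = (if b then [:: 1] else [::]) ++ [seq p.+1 | p <- ones B].
Proof. by rewrite -cat1s ones_cat; case: b. Qed.

Lemma size_ones B : size (ones B) = count id B.
Proof.
by elim: B => // b B IH; rewrite ones_cons size_cat size_map IH; case: b.
Qed.

Lemma ones_nseq_false k : ones (nseq k false) = [::].
Proof. by apply/size0nil; rewrite size_ones count_nseq. Qed.

(** A word has exactly [W] bits, so a shorter bitvector is read back with trailing zeros; this and
    [rank1_pad] make that padding harmless. *)
Lemma ones_pad B k : ones (B ++ nseq k false) = ones B.
Proof. by rewrite ones_cat ones_nseq_false cats0. Qed.

Lemma mem_ones B p : (p \in ones B) = (0 < p <= size B) && nth false B p.-1.
Proof. by rewrite mem_filter mem_iota add1n ltnS andbC. Qed.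

Lemma rank1_pad B k i : rank1 (B ++ nseq k false) i = rank1 B i.
Proof.
rewrite /rank1 take_cat; case: ltnP => // le_B_i.
rewrite count_cat (take_oversize le_B_i).
have /all_pred1P-> : all (pred1 false) (take (i - size B) (nseq k false)).
  by apply/allP => b /mem_take /nseqP[-> _].
by rewrite count_nseq addn0.
Qed.

Lemma rank1_le_count B i : rank1 B i <= count id B.
Proof. by rewrite -[in leqRHS](cat_take_drop i B) count_cat leq_addr. Qed.

(** Isolating the 1 at position [c] puts [B] in a form on which rank and select compute by the
    concatenation rules. *)
Lemma nth_split_bit B c : 0 < c -> nth false B c.-1 ->
  exists B1 B2, B = B1 ++ true :: B2 /\ size B1 = c.-1.
Proof.
move=> c_gt0 Bc; have lt_c : c.-1 < size B.
  by case: ltnP Bc => // le_B; rewrite nth_default.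
exists (take c.-1 B), (drop c B); split; last by rewrite size_takel // ltnW.
by rewrite -[LHS](cat_take_drop c.-1) (drop_nth false) // Bc prednK.
Qed.

Lemma rank1_gt0 B c : 0 < c -> nth false B c.-1 -> 0 < rank1 B c.
Proof.
move=> c_gt0 /(nth_split_bit c_gt0)[B1 [B2 [-> szB]]].
rewrite /rank1 take_cat szB ifF; last by lia.
have ->: c - c.-1 = 1 by lia.
by rewrite count_cat /= take0 /= addn1.
Qed.

(** Exactly [rank1 B c - 1] ones precede a 1 at position [c], so [c] is the next entry of [ones B].
    This is what makes compaction invertible. *)
Lemma select1_rank1 B c : 0 < c -> nth false B c.-1 -> select1 B (rank1 B c) = c.
Proof.
move=> c_gt0 /(nth_split_bit c_gt0)[B1 [B2 [-> szB]]].
rewrite /rank1 take_cat szB ifF; last by lia.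
have ->: c - c.-1 = 1 by lia.
rewrite count_cat /= take0 /= addn1 /select1 ones_cat ones_cons nth_cat size_ones ltnn.
by rewrite subnn /= szB; lia.
Qed.

(** The encoding puts the first bit in the least significant place, so each halving drops the head
    of [B]. *)
Lemma odd_word_of B j : odd (word_of B %/ 2 ^ j) = nth false B j.
Proof.
elim: B j => [|b B IH] [|j] /=; rewrite ?div0n ?nth_nil //.
  by rewrite divn1 oddD odd_double addbF oddb.
by rewrite expnS divnMA divn2 half_bit_double IH.
Qed.

Lemma bits_of_word_of W B :
  size B <= W -> bits_of W (word_of B) = B ++ nseq (W - size B) false.
Proof.
move=> le_B_W; apply: (@eq_from_nth _ false).
  by rewrite size_mkseq size_cat size_nseq subnKC.
move=> j; rewrite size_mkseq => lt_j_W; rewrite nth_mkseq // odd_word_of nth_cat.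
by case: ltnP => // le_B_j; rewrite nth_default // nth_nseq if_same.
Qed.

Lemma select1_word_of W B j :
  size B <= W -> select1 (bits_of W (word_of B)) j = select1 B j.
Proof. by move=> le_B_W; rewrite bits_of_word_of // /select1 ones_pad. Qed.

Lemma rank1_word_of W B j :
  size B <= W -> rank1 (bits_of W (word_of B)) j = rank1 B j.
Proof. by move=> le_B_W; rewrite bits_of_word_of // rank1_pad. Qed.

Lemma pred1_word_of W B j :
  size B <= W -> Defs.pred1 (bits_of W (word_of B)) j = Defs.pred1 B j.
Proof. by move=> le_B_W; rewrite bits_of_word_of // /Defs.pred1 ones_pad. Qed.

(** * Alphabet compaction *)

Definition over_alphabet (sigma : nat) (g : seq nat) : bool :=
  all (fun c => 1 <= c <= sigma) g.

Lemma size_alphabet_bits sigma g : size (alphabet_bits sigma g) = sigma.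
Proof. by rewrite size_map size_iota. Qed.

Lemma nth_alphabet_bits sigma g c :
  1 <= c <= sigma -> nth false (alphabet_bits sigma g) c.-1 = (c \in g).
Proof.
move=> c_ok; have lt_c : c.-1 < sigma by lia.
by rewrite (nth_map 0) ?size_iota // nth_iota // add1n prednK //; case/andP: c_ok.
Qed.

(** Re-establishes the alphabet hypothesis for the children, whose parent alphabet is the compact
    one. *)
Lemma over_compact sigma g (A := alphabet_bits sigma g) :
  over_alphabet sigma g -> over_alphabet (count id A) (compact A g).
Proof.
move=> /allP g_ok; rewrite /over_alphabet all_map; apply/allP => c gc /=.
have /andP[c_gt0 _] := g_ok _ gc.
by rewrite rank1_le_count rank1_gt0 // nth_alphabet_bits ?g_ok.
Qed.

Lemma select1_compact sigma g i (A := alphabet_bits sigma g) :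
  over_alphabet sigma g -> 1 <= i <= size g -> select1 A (at1 (compact A g) i) = at1 g i.
Proof.
move=> /allP g_ok i_ok; have lt_i : i.-1 < size g by lia.
rewrite /at1 (nth_map 0) //; have gc := mem_nth 0 lt_i.
have /andP[c_gt0 _] := g_ok _ gc.
by rewrite select1_rank1 // nth_alphabet_bits ?g_ok.
Qed.

(** * Parts and groups *)

Lemma size_parts len g : size (parts len g) = (size g + len.-1) %/ len.
Proof. by rewrite size_reshape size_nseq. Qed.

Lemma flatten_take_parts len g k :
  0 < len -> flatten (take k (parts len g)) = take (k * len) g.
Proof.
move=> len_gt0; rewrite /parts; move DN: (_ %/ _) => N.
(* [N] is the ceiling of [size g / len], so the parts exhaust [g] and [k] may be capped at [N]. *)
have le_g : size g <= N * len.
  by rewrite -DN; have := divn_eq (size g + len.-1) len;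
    have := ltn_pmod (size g + len.-1) len_gt0; lia.
transitivity (take (minn k N * len) g); last first.
  have [le_kN|lt_Nk] := leqP k N; first by [].
  by rewrite !take_oversize //; apply: leq_trans le_g _; rewrite leq_mul2r ltnW ?orbT.
elim: N k g {DN le_g} => [|N IH] [|k] g /=; rewrite ?minn0 ?mul0n ?take0 //.
by rewrite IH minnSS mulSn takeD.
Qed.

Lemma mem_parts_size len g p : p \in parts len g -> size p <= len.
Proof.
rewrite /parts; move: (_ %/ _) => N; elim: N g => [|N IH] g //=; rewrite inE.
by case/orP=> [/eqP->|/IH //]; rewrite size_take_min geq_minl.
Qed.

(** A group is kept as its list of parts, not as their concatenation, so that part boundaries stay
    visible. *)
Definition mergeable (w : nat) (q : seq (seq nat)) : bool :=
  (0 < size q) && ((size q == 1) || (nruns (flatten q) <= w)).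

(** Generalized over the accumulator: the pair [k], [cur] is represented by the list [r] of parts
    merged so far. *)
Lemma merge_partsP w r ps : mergeable w r ->
  exists qs, [/\ merge_parts w (size r) (flatten r) ps
                   = [seq (size q, flatten q) | q <- qs],
                 flatten qs = r ++ ps & all (mergeable w) qs].
Proof.
elim: ps r => [|p ps IH] r r_ok /=.
  by exists [:: r]; rewrite /= cats0 r_ok.
case: ifP => [le_w | _].
  have -> : flatten r ++ p = flatten (rcons r p) by rewrite -cats1 flatten_cat /= cats0.
  rewrite -(size_rcons r p); case: (IH (rcons r p)) => [|qs [-> Fqs qs_ok]].
    by rewrite /mergeable size_rcons -cats1 flatten_cat /= cats0 le_w orbT.
  by exists qs; rewrite Fqs cat_rcons.
case: (IH [:: p]) => [//|qs [/= Eqs Fqs qs_ok]]; exists (r :: qs).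
by rewrite /= r_ok Fqs; split=> //; rewrite -Eqs cats0.
Qed.

Lemma groupsP w ps :
  exists qs, [/\ groups w ps = [seq (size q, flatten q) | q <- qs],
                 flatten qs = ps & all (mergeable w) qs].
Proof.
case: ps => [|p ps] /=; first by exists [::].
have [//|qs [Eqs Fqs qs_ok]] := @merge_partsP w [:: p] ps.
by exists qs; rewrite -Eqs /= cats0.
Qed.

Lemma flatten_split (T : Type) (qs : seq (seq T)) b : b < size (flatten qs) ->
  exists qs1 q qs2, qs = qs1 ++ q :: qs2 /\
    size (flatten qs1) <= b < size (flatten qs1) + size q.
Proof.
elim: qs b => [|q qs IH] b //=; rewrite size_cat => lt_b.
have [lt_bq|le_qb] := ltnP b (size q); first by exists [::], q, qs.
have [|qs1 [q' [qs2 [-> lim]]]] := IH (b - size q); first by lia.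
by exists (q :: qs1), q', qs2; split=> //=; rewrite size_cat; lia.
Qed.

(* The group [q] that covers the 0-based position [j] of [g]. *)
Lemma groups_split w len g j : 0 < len -> j < size g ->
  exists qs1 q qs2 o,
    [/\ o = size (flatten qs1) /\ groups w (parts len g)
          = [seq (size q, flatten q) | q <- qs1 ++ q :: qs2],
        all (mergeable w) (qs1 ++ q :: qs2),
        size (flatten (qs1 ++ q :: qs2)) = (size g + len.-1) %/ len,
        o <= j %/ len < o + size q &
        [/\ j < o * len + size (flatten q),
            nth 0 (flatten q) (j - o * len) = nth 0 g j,
            w < nruns (flatten q) -> size (flatten q) <= len
          & {subset flatten q <= g}]].
Proof.
move=> len_gt0 lt_j; have [qs [Eqs Fqs qs_ok]] := groupsP w (parts len g).
have lt_jN : j %/ len < size (flatten qs).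
  (* For nonempty [g] the ceiling of [size g / len] equals [(size g - 1) %/ len + 1], which exceeds
     the 0-based part number of [j]. *)
  rewrite Fqs size_parts (_ : _ + len.-1 = size g - 1 + len); last by lia.
  by rewrite divnDr ?dvdnn // divnn len_gt0 addn1 ltnS leq_div2r //; lia.
have [qs1 [q [qs2 [Dqs lim]]]] := flatten_split lt_jN.
(* Both ends of [q] are part boundaries, so the parts up to either end form a prefix of the part
   list and concatenate to a prefix of [g]. *)
have [Dq1 Dq2] : flatten qs1 = take (size (flatten qs1)) (parts len g) /\
    flatten qs1 ++ q = take (size (flatten qs1) + size q) (parts len g).
  rewrite -Fqs Dqs flatten_cat /= catA; split; last by rewrite -size_cat take_size_cat.
  by rewrite -catA take_size_cat.
pose o := size (flatten qs1); exists qs1, q, qs2, o; rewrite -Dqs; split=> //; first by rewrite Fqs size_parts.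
have F1 : flatten (flatten qs1) = take (o * len) g by rewrite Dq1 flatten_take_parts.
have F2 : flatten (flatten qs1) ++ flatten q = take ((o + size q) * len) g.
  by rewrite -flatten_cat Dq2 flatten_take_parts.
have le_oj : o * len <= j by rewrite -leq_divRL //; lia.
have lt_jo : j < (o + size q) * len by rewrite -ltn_divLR //; lia.
have S1 : size (flatten (flatten qs1)) = o * len.
  by rewrite F1 size_takel //; lia.
split.
- rewrite -S1 -size_cat F2 size_take_min; lia.
- rewrite -(nth_take 0 lt_jo) -F2 nth_cat S1 ifF //; lia.
(* With more than [w] runs the group must be a single part, whose length is at most [len]. *)
- have : mergeable w q by apply: (allP qs_ok); rewrite Dqs mem_cat inE eqxx orbT.
  case/andP => _ /orP[/eqP|]; last by lia.
  move=> szq _; case: q szq {Eqs lim lt_jo F2} Dqs Dq2 => [|p [|]] //= _ Dqs _.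
  rewrite cats0; apply: (@mem_parts_size _ g); rewrite -Fqs Dqs flatten_cat /=.
  by rewrite mem_cat inE eqxx orbT.
- by move=> c qc; apply: (@mem_take ((o + size q) * len) nat); rewrite -F2 mem_cat qc orbT.
Qed.

(** * Start bitvectors of internal nodes *)

Definition start_marks (qs : seq (seq (seq nat))) : bitseq :=
  flatten [seq true :: nseq (size q).-1 false | q <- qs].

Lemma size_start_marks w qs :
  all (mergeable w) qs -> size (start_marks qs) = size (flatten qs).
Proof.
elim: qs => //= q qs IH /andP[/andP[q_gt0 _] /IH {}IH].
by rewrite /start_marks /= !size_cat size_nseq -/(start_marks qs) IH; lia.
Qed.

Lemma count_start_marks qs : count id (start_marks qs) = size qs.
Proof.
elim: qs => //= q qs IH.
by rewrite /start_marks /= count_cat -/(start_marks qs) IH count_nseq.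
Qed.

Lemma start_bitsE f qs :
  start_bits f [seq (size q, flatten q) | q <- qs]
    = start_marks qs ++ nseq (f - size (start_marks qs)) false.
Proof. by rewrite /start_bits -map_comp. Qed.

(** Each group contributes a single 1, at its first part. The last 1 not after a part of [q] is thus
    the start of [q], and the ones up to it count the groups of [qs1] and [q]. Parts are 0-based in
    [b] and [o] but 1-based in [X]. *)
Lemma start_bits_split f w qs1 q qs2 b (o := size (flatten qs1))
    (X := start_bits f [seq (size q, flatten q) | q <- qs1 ++ q :: qs2]) :
  all (mergeable w) (qs1 ++ q :: qs2) -> o <= b < o + size q ->
  Defs.pred1 X b.+1 = o.+1 /\ rank1 X o.+1 = (size qs1).+1.
Proof.
move=> qs_ok lim; rewrite /X start_bitsE /Defs.pred1 ones_pad rank1_pad.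
have sz1 : size (start_marks qs1) = o.
  by apply: (@size_start_marks w); move: qs_ok; rewrite all_cat => /andP[].
have -> : start_marks (qs1 ++ q :: qs2) =
    (start_marks qs1 ++ true :: nseq (size q).-1 false) ++ start_marks qs2.
  by rewrite /start_marks map_cat flatten_cat /= -catA.
split; last first.
  rewrite /rank1 -catA take_cat sz1 ifF ?count_cat; last by lia.
  by rewrite subSnn /= take0 count_start_marks /= addn1.
rewrite !ones_cat ones_cons ones_nseq_false /= !filter_cat sz1 addn1 /=.
rewrite (_ : o < b.+1); last by lia.
(* The ones of later groups lie beyond the last part of [q], hence beyond [b.+1]. *)
set s2 := filter _ [seq _ | _ <- ones (start_marks qs2)]; have -> : s2 = [::].
  apply/eqP; rewrite -size_eq0 size_filter -leqn0 leqNgt -has_count.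
  apply/hasPn => _ /mapP[p p_in ->]; move: p_in; rewrite mem_ones size_cat /= size_nseq.
  by rewrite sz1; lia.
by rewrite cats0 last_cat.
Qed.

(** * Run-length encoding *)

Lemma rle_cons c s :
  exists k r, rle (c :: s) = (c, k) :: r.
Proof.
rewrite /=; case: (rle s) => [|[d k] r]; first by exists 1, [::].
by case: eqP => [->|_]; [exists k.+1, r | exists 1, ((d, k) :: r)].
Qed.

Lemma nruns_cons2 c d s : nruns [:: c, d & s] = (c != d) + nruns (d :: s).
Proof.
rewrite /nruns; have [k [r E]] := rle_cons d s.
by rewrite -[rle [:: c, d & s]]/(if rle (d :: s) is (e, k) :: r then _ else _) E; case: eqP.
Qed.

(** Renaming symbols can merge runs but never split one. The threshold is tested before compaction,
    while a leaf encodes the compacted fragment. *)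
Lemma nruns_map (h : nat -> nat) s : nruns (map h s) <= nruns s.
Proof.
elim: s => [|c [|d s] IH] //; rewrite !map_cons !nruns_cons2 in IH *.
by apply: leq_add IH; case: (eqVneq c d) => [->|_]; rewrite ?eqxx ?leq_b1.
Qed.

Lemma nruns_le_size s : nruns s <= size s.
Proof.
by elim: s => [|c [|d s] IH] //; rewrite nruns_cons2; apply: leq_add (leq_b1 _) IH.
Qed.

Definition unrle (E : seq (nat * nat)) : seq nat :=
  flatten [seq nseq p.2 p.1 | p <- E].

Lemma rleK : cancel rle unrle.
Proof.
elim=> [|c s IH] //=; case: (rle s) IH => [|[d k] r] IH /=; first by rewrite -IH.
by case: eqP => [->|_]; rewrite -IH.
Qed.

(** * Program logic *)

(** Total correctness in weakest-precondition style. The time is an upper bound, so costs can be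
    rounded up and added; sequencing nests one [runs] in the postcondition of another. *)
Definition runs (W : nat) (m : seq nat) (c : cmd) (s : state) (t : nat)
    (Q : state -> Prop) : Prop :=
  exists s' t', [/\ exec W m c s s' t', t' <= t & Q s'].

Section Runs.

Variables (W : nat) (m : seq nat).
Implicit Types (s : state) (Q : state -> Prop).

Lemma runs_le c s t1 t2 Q : t1 <= t2 -> runs W m c s t1 Q -> runs W m c s t2 Q.
Proof.
by move=> le_t [s' [t' [ex le_t' Qs']]]; exists s', t'; split=> //; apply: leq_trans le_t.
Qed.

Lemma runs_skip s Q : Q s -> runs W m Skip s 1 Q.
Proof. by move=> Qs; exists s, 1; split=> //; apply: ExecSkip. Qed.

Lemma runs_assign r e v s Q : eval W m s e = v ->
  Q (State (update (reg s) r v) (work s)) -> runs W m (Assign r e) s (cost e).+1 Q.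
Proof. by move=> <- Qs; do 2!eexists; split; [apply: ExecAssign | |]. Qed.

Lemma runs_write e1 e2 v1 v2 s Q : eval W m s e1 = v1 -> eval W m s e2 = v2 ->
  Q (State (reg s) (update (work s) v1 v2)) ->
  runs W m (Write e1 e2) s (cost e1 + cost e2).+1 Q.
Proof. by move=> <- <- Qs; do 2!eexists; split; [apply: ExecWrite | |]. Qed.

Lemma runs_seq c1 c2 s t1 t2 Q :
  runs W m c1 s t1 (fun s1 => runs W m c2 s1 t2 Q) ->
  runs W m (Seq c1 c2) s (t1 + t2).+1 Q.
Proof.
move=> [s1 [t1' [ex1 le1 [s2 [t2' [ex2 le2 Qs2]]]]]].
by exists s2, (t1' + t2').+1; split=> //; [apply: ExecSeq ex1 ex2 | rewrite ltnS leq_add].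
Qed.

Lemma runs_if e c1 c2 s t Q :
  runs W m (if eval W m s e == 0 then c2 else c1) s t Q ->
  runs W m (If e c1 c2) s (cost e + t).+1 Q.
Proof.
move=> [s' [t' [ex le_t' Qs']]]; exists s', (cost e + t').+1.
split=> //; last by rewrite ltnS leq_add2l.
by case: eqP ex => [/ExecIfFalse | /eqP/ExecIfTrue]; apply.
Qed.

Lemma runs_while0 e c s Q : eval W m s e = 0 -> Q s -> runs W m (While e c) s (cost e).+1 Q.
Proof. by move=> e0 Qs; exists s, (cost e).+1; split=> //; apply: ExecWhileFalse. Qed.

Lemma runs_whileS e c s t1 t2 Q : eval W m s e != 0 ->
  runs W m c s t1 (fun s1 => runs W m (While e c) s1 t2 Q) ->
  runs W m (While e c) s (cost e + t1 + t2).+1 Q.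
Proof.
move=> e_neq0 [s1 [t1' [ex1 le1 [s2 [t2' [ex2 le2 Qs2]]]]]].
exists s2, (cost e + t1' + t2').+1; split=> //; last by lia.
by apply: ExecWhileTrue e_neq0 ex1 ex2.
Qed.

Lemma eval_const s c : c < 2 ^ W -> eval W m s (Const c) = c.
Proof. exact: modn_small. Qed.

Lemma eval_data s e p : eval W m s e = p -> eval W m s (DataAt e) = nth 0 m p.
Proof. by move=> <-. Qed.

Lemma eval_op s o e1 e2 u v : eval W m s e1 = u -> eval W m s e2 = v ->
  eval W m s (Op o e1 e2) = eval_binop W o u v.
Proof. by move=> <- <-. Qed.

Lemma eval_add s e1 e2 u v : eval W m s e1 = u -> eval W m s e2 = v ->
  u + v < 2 ^ W -> eval W m s (Op OAdd e1 e2) = u + v.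
Proof. by move=> <- <- /modn_small. Qed.

(** With [v <= u] the machine computes [u - v] plus exactly one modulus, which the reduction
    removes. *)
Lemma eval_sub s e1 e2 u v : eval W m s e1 = u -> eval W m s e2 = v ->
  v <= u < 2 ^ W -> eval W m s (Op OSub e1 e2) = u - v.
Proof.
move=> <- <- /andP[le_vu lt_u] /=.
move: (2 ^ W) (eval _ _ _ _) (eval _ _ _ _) le_vu lt_u => N u' v' le_vu lt_u.
by rewrite (_ : _ + _ = u' - v' + N) ?modnDr ?modn_small //; lia.
Qed.

Lemma eval_mul s e1 e2 u v : eval W m s e1 = u -> eval W m s e2 = v ->
  u * v < 2 ^ W -> eval W m s (Op OMul e1 e2) = u * v.
Proof. by move=> <- <- /modn_small. Qed.

End Runs.

(** * The access program *)

(* Registers: 0 address of the current node, then the symbol; 1 local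
   position; 2 length of the current fragment; 3 branching factor; 4 part
   number; 5 height of the stack kept at the bottom of the work memory. *)

Definition descend_body : cmd :=
  Seq (Write (Reg 5) (DataAt (Op OAdd (Reg 0) (Const 1))))
  (Seq (Assign 5 (Op OAdd (Reg 5) (Const 1)))
  (Seq (Assign 2 (Op ODiv (Reg 2) (Reg 3)))
  (Seq (Assign 4 (Op OPred (DataAt (Op OAdd (Reg 0) (Const 2)))
                     (Op OAdd (Op ODiv (Op OSub (Reg 1) (Const 1)) (Reg 2)) (Const 1))))
  (Seq (Assign 1 (Op OSub (Reg 1) (Op OMul (Op OSub (Reg 4) (Const 1)) (Reg 2))))
       (Assign 0 (DataAt (Op OAdd (Op OAdd (Reg 0) (Const 2))
           (Op ORank (DataAt (Op OAdd (Reg 0) (Const 2))) (Reg 4))))))))).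

Definition descend : cmd := While (DataAt (Reg 0)) descend_body.

(** The position still exceeds the length of the current run. No run counter is needed, because a
    position inside the fragment stops the scan at the last run at the latest. *)
Definition scan_guard : expr := Op OLt (DataAt (Op OAdd (Reg 0) (Const 1))) (Reg 1).

Definition scan_body : cmd :=
  Seq (Assign 1 (Op OSub (Reg 1) (DataAt (Op OAdd (Reg 0) (Const 1)))))
      (Assign 0 (Op OAdd (Reg 0) (Const 2))).

Definition scan : cmd := While scan_guard scan_body.

Definition ascend_body : cmd :=
  Seq (Assign 5 (Op OSub (Reg 5) (Const 1)))
      (Assign 0 (Op OSelect (WorkAt (Reg 5)) (Reg 0))).

Definition ascend : cmd := While (Reg 5) ascend_body.

(** Two header cells precede the table and each entry takes two cells; the block number in register
    4 is 0-based. *)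
Definition entry_addr : expr :=
  Op OAdd (Op OAdd (Reg 0) (Const 2)) (Op OAdd (Reg 4) (Reg 4)).

Definition find_top_block : cmd :=
  Seq (Assign 2 (DataAt (Reg 0)))
  (Seq (Assign 3 (DataAt (Op OAdd (Reg 0) (Const 1))))
  (Seq (Assign 4 (Op ODiv (Op OSub (Reg 1) (Const 1)) (Reg 2)))
  (Seq (If (DataAt entry_addr) Skip
           (Assign 4 (Op OSub (Reg 4) (DataAt (Op OAdd entry_addr (Const 1))))))
  (Seq (Assign 0 (DataAt (Op OAdd entry_addr (Const 1))))
       (Assign 1 (Op OSub (Reg 1) (Op OMul (Reg 4) (Reg 2)))))))).

(** Between descent and scan the bitvector of the leaf is pushed as well, since [E] is written over
    the leaf's own compact alphabet; register 0 then skips the three header cells. *)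
Definition access_program : cmd :=
  Seq find_top_block
  (Seq descend
  (Seq (Seq (Write (Reg 5) (DataAt (Op OAdd (Reg 0) (Const 1))))
       (Seq (Assign 5 (Op OAdd (Reg 5) (Const 1)))
            (Assign 0 (Op OAdd (Reg 0) (Const 3)))))
  (Seq scan
  (Seq (Assign 0 (DataAt (Reg 0)))
       ascend)))).

(** * Reading stored sequences and encoded runs *)

Lemma storedP m a s : reflect (a + size s <= size m /\
  forall j, j < size s -> nth 0 m (a + j) = nth 0 s j) (stored m a s).
Proof.
apply: (iffP andP) => -[le_m]; last first.
  move=> nth_s; split=> //; apply/eqP/(@eq_from_nth _ 0).
    by rewrite size_takel // size_drop; lia.
  move=> j; rewrite size_takel ?size_drop; last by lia.
  by move=> lt_j; rewrite nth_take // nth_drop nth_s.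
by move/eqP=> Ds; split=> // j lt_j; rewrite -Ds nth_take // nth_drop.
Qed.

Lemma unrle_cons c k E : unrle ((c, k) :: E) = nseq k c ++ unrle E.
Proof. by []. Qed.

Lemma size_pair_cells E : size (pair_cells E) = (size E).*2.
Proof. by elim: E => //= p E IH; rewrite /pair_cells /= -/(pair_cells E) IH. Qed.

Lemma const_lt_word W c : 64 <= W -> c < 64 -> c < 2 ^ W.
Proof.
move=> W_ge lt_c; apply: ltn_trans lt_c _.
by apply: leq_ltn_trans W_ge _; apply: ltn_expl.
Qed.

(** * Correctness and running time of the three loops *)

Section Loops.

Variables (W : nat) (m : seq nat).
Hypotheses (W_ge : 64 <= W) (m_ok : valid_memory W m).

Let size_m : size m <= 2 ^ W. Proof. by case/andP: m_ok. Qed.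

Let small c : c < 64 -> c < 2 ^ W. Proof. exact: const_lt_word. Qed.

(** Each iteration drops the first run and subtracts its length from the position. Register 5 and
    the work memory are preserved for the ascent. *)
Lemma scan_runs E p i s :
  stored m p (pair_cells E) -> 1 <= i <= size (unrle E) -> i < 2 ^ W ->
  reg s 0 = p -> reg s 1 = i ->
  runs W m scan s (20 * (size E).+1) (fun s' =>
    [/\ nth 0 m (reg s' 0) = at1 (unrle E) i, reg s' 5 = reg s 5
      & work s' = work s]).
Proof.
elim: E p i s => [|[c k] E IH] p i s /=; first by lia.
move=> /storedP[le_m nth_E] i_ok lt_i s0 s1.
have {le_m} le_m : p + 2 + size (pair_cells E) <= size m by move: le_m; rewrite !size_pair_cells /=; lia.
have m0 : nth 0 m p = c by rewrite -[p]addn0 nth_E ?size_pair_cells.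
have m1 : nth 0 m (p + 1) = k by rewrite nth_E ?size_pair_cells.
have ev1 s' : reg s' 0 = p ->
    eval W m s' (DataAt (Op OAdd (Reg 0) (Const 1))) = k.
  move=> s'0; rewrite -m1; apply/eval_data/eval_add => //; last by lia.
  exact/eval_const/small.
have evg : eval W m s scan_guard = (k < i) by exact: eval_op (ev1 _ s0) (s1 : eval W m s (Reg 1) = i).
move: i_ok; rewrite unrle_cons size_cat size_nseq => i_ok.
have [lt_ki|le_ik] := ltnP k i; last first.
  apply: (@runs_le _ _ _ _ 7); first by lia.
  apply: runs_while0; first by rewrite evg; lia.
  by split=> //; rewrite s0 m0 /at1 nth_cat size_nseq nth_nseq !ifT //; lia.
(* The guard costs 6, the body 12 and the loop step 1, so 20 per run suffices. *)
apply: (@runs_le _ _ _ _ (6 + 12 + 20 * (size E).+1).+1); first by lia.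
apply: runs_whileS; first by rewrite evg lt_ki.
apply: (@runs_le _ _ _ _ (7 + 4).+1) => //; apply: runs_seq.
apply: (@runs_le _ _ _ _ 7) => //.
apply: (runs_assign (v := i - k)); first by apply: eval_sub (s1 : eval W m s (Reg 1) = i) (ev1 _ s0) _; lia.
(* The position lies beyond the first run, so another pair follows and [p + 2] is still an address
   of the memory. *)
have sz : 1 < size (pair_cells E).
  by rewrite size_pair_cells; case: E {IH nth_E le_m} i_ok => [|[d k'] E] //=; lia.
apply: (runs_assign (v := p + 2)).
  by apply: eval_add; [exact: s0 | exact/eval_const/small | lia].
apply: (@runs_le _ _ _ _ (20 * (size E).+1)) => //.
have [|||s' [t' [ex le_t' [Q1 Q2 Q3]]]] :=
  IH (p + 2) (i - k) (State (update (update (reg s) 1 (i - k)) 0 (p + 2)) (work s)) _ _ _ erefl erefl.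
- apply/storedP; split; first by lia.
  by move=> j lt_j; rewrite -addnA nth_E //; move: lt_j; rewrite !size_pair_cells /=; lia.
- by lia.
- by lia.
exists s', t'; split=> //; split=> //; rewrite Q1 /at1 nth_cat size_nseq ifF; last by lia.
by congr nth; lia.
Qed.

(** The stack is popped from its top, so the induction removes the last bitvector, the one that
    [foldr] applies first. *)
Lemma ascend_runs As c s :
  all (fun A => size A <= W) As -> size As < 2 ^ W ->
  (forall j, j < size As -> work s j = word_of (nth [::] As j)) ->
  reg s 0 = c -> reg s 5 = size As ->
  runs W m ascend s (20 * (size As).+1)
    (fun s' => answer s' = foldr select1 c As).
Proof.
elim/last_ind: As c s => [|As A IH] c s.
  move=> _ _ _ s0 s5; apply: (@runs_le _ _ _ _ 2) => //.
  exact: runs_while0.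
rewrite all_rcons size_rcons => /andP[A_ok As_ok] lt_As work_s s0 s5.
apply: (@runs_le _ _ _ _ (1 + 10 + 20 * (size As).+1).+1); first by lia.
apply: runs_whileS; first by rewrite /= s5.
apply: (@runs_le _ _ _ _ (4 + 5).+1) => //; apply: runs_seq.
apply: (runs_assign (v := size As)).
  rewrite (eval_sub (s5 : eval W m s (Reg 5) = _) (eval_const _ _ (small (_ : 1 < 64)))) //; lia.
apply: (runs_assign (v := select1 A c)).
  by rewrite /= /update /= s0 work_s ?size_rcons // nth_rcons ltnn eqxx select1_word_of.
apply: (@runs_le _ _ _ _ (20 * (size As).+1)) => //.
have [||s' [t' [ex le_t' Q']]] := IH (select1 A c)
    (State (update (update (reg s) 5 (size As)) 0 (select1 A c)) (work s)) As_ok _ _ erefl erefl.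
- exact: ltnW.
- by move=> j lt_j; rewrite work_s ?size_rcons ?nth_rcons ?lt_j // ltnS ltnW.
by exists s', t'; split=> //; rewrite Q' foldr_rcons.
Qed.

Lemma node_at_leaf p A E : node_at m p (Leaf A E) ->
  stored m p ([:: 0; word_of A; size E] ++ pair_cells E).
Proof. by move=> H; inversion H. Qed.

Lemma node_at_inner p A X P : node_at m p (Inner A X P) ->
  exists ptrs, [/\ stored m p ([:: 1; word_of A; word_of X] ++ ptrs),
    size ptrs = size P
    & forall j, j < size P -> node_at m (nth 0 ptrs j) (nth (Leaf [::] [::]) P j)].
Proof. by move=> H; inversion H; exists ptrs. Qed.

(* The alphabet bitvectors of the internal nodes on the path are pushed on the
   work memory from address [d] on. *)
Definition leaf_reached (w h d i c : nat) (s s' : state) : Prop :=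
  exists As A E i',
  [/\ stored m (reg s' 0) ([:: 0; word_of A; size E] ++ pair_cells E) /\ size E <= w,
      reg s' 1 = i' /\ 1 <= i' <= minn i (size (unrle E)),
      all (fun B => size B <= W) (rcons As A) /\ size As <= h,
      [/\ reg s' 5 = d + size As,
          forall j, j < size As -> work s' (d + j) = word_of (nth [::] As j)
        & forall j, j < d -> work s' j = work s j]
    & foldr select1 (at1 (unrle E) i') (rcons As A) = c].

(** The tag 0 of a leaf fails the loop guard at once; no internal node is visited and only the
    leaf's own bitvector remains to be inverted. *)
Lemma descend_leaf w h k sigma g p i d s :
  let A := alphabet_bits sigma g in
  sigma <= W -> over_alphabet sigma g -> nruns g <= w ->
  node_at m p (Leaf A (rle (compact A g))) -> 1 <= i <= size g ->
  reg s 0 = p -> reg s 1 = i -> reg s 5 = d ->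
  runs W m descend s (60 * k.+1) (leaf_reached w h d i (at1 g i) s).
Proof.
move=> A le_sigma g_ok le_w /node_at_leaf pA i_ok s0 s1 s5.
apply: (@runs_le _ _ _ _ 3); first by lia.
apply: runs_while0.
  by rewrite /= s0; case/storedP: pA => _ /(_ 0 isT); rewrite addn0.
exists [::], A, (rle (compact A g)), i; rewrite rleK size_map s0 s1 s5 addn0.
split=> //; last exact: select1_compact.
- by split=> //; apply: leq_trans (nruns_map _ _) le_w.
- by split=> //; rewrite leq_min leqnn; case/andP: i_ok => -> ->.
- by rewrite /= size_alphabet_bits le_sigma.
Qed.

(** Induction on the level. The length bound is conditional because a merged fragment may exceed
    [f ^ k]; only fragments with more than [w] runs are cut further. *)
Lemma descend_runs f y k sigma g p i d s (w := f ^ y) :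
  1 < f <= W -> sigma <= W -> over_alphabet sigma g -> (w < nruns g -> size g <= f ^ k) ->
  node_at m p (build_node f w k sigma g) ->
  1 <= i <= size g -> i < 2 ^ W -> d + k < 2 ^ W ->
  reg s 0 = p -> reg s 1 = i -> reg s 2 = f ^ k -> reg s 3 = f -> reg s 5 = d ->
  runs W m descend s (60 * (k - y).+1) (leaf_reached w (k - y) d i (at1 g i) s).
Proof.
move=> f_ok.
elim: k sigma g p i d s => [|k IH] sigma g p i d s le_sigma g_ok g_size /=.
  move=> node_p i_ok lt_i lt_d s0 s1 _ _ s5; apply: (@descend_leaf _ _ _ sigma g p) => //.
  (* At level 0 such a fragment has at most one symbol, hence at most one run, while [w] is
     positive. *)
  rewrite leqNgt; apply/negP => lt_w; have := g_size lt_w; have := nruns_le_size g.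
  have : 0 < w by rewrite expn_gt0; lia.
  by rewrite expn0; lia.
have [le_w|lt_w] := leqP (nruns g) w.
  by move=> node_p i_ok lt_i lt_d s0 s1 _ _ s5; apply: (@descend_leaf _ _ _ sigma g p).
move/(_ lt_w) in g_size.
(* Runs are at most symbols, so [f ^ y < f ^ k.+1]: every internal node uses up one of the levels
   above [y]. *)
have lt_yk : y < k.+1.
  rewrite -(@ltn_exp2l f) //; last by case/andP: f_ok.
  by apply: leq_trans lt_w _; apply: leq_trans g_size; apply: nruns_le_size.
set A := alphabet_bits _ _; set h := compact A g; set gs := groups _ _.
move=> /node_at_inner[ptrs [/storedP[le_m nth_ptrs] sz_ptrs node_ptrs]].
move=> i_ok lt_i lt_d s0 s1 s2 s3 s5.
have len_gt0 : 0 < f ^ k by rewrite expn_gt0; lia.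
have sz_h : size h = size g by rewrite size_map.
have lt_ih : i.-1 < size h by lia.
have [qs1 [q [qs2 [o [[Do Dgs] qs_ok sz_qs o_ok [lt_iq nth_q q_size q_h]]]]]] :=
  groups_split w len_gt0 lt_ih.
rewrite -/gs in Dgs; rewrite Dgs in node_ptrs sz_ptrs nth_ptrs le_m.
set X := start_bits _ _ in nth_ptrs le_m.
move: (qs_ok) (o_ok); rewrite Do => /start_bits_split/[apply] /(_ f); rewrite -/X -Do.
rewrite -subn1 -(addn1 o) -(addn1 (_ %/ _)) => -[pred_X rank_X].
have le_XW : size X <= W.
  rewrite /X start_bitsE size_cat size_nseq (size_start_marks qs_ok) sz_qs.
  (* At most [f] parts of length [f ^ k] cover at most [f ^ k.+1] symbols, so [X] has [f] bits and
     fits in a word. *)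
  suff: (size h + (f ^ k).-1) %/ f ^ k <= f by lia.
  rewrite -ltnS ltn_divLR // sz_h mulSn; move: g_size; rewrite expnS; lia.
have lt_q : size qs1 < size ptrs by rewrite sz_ptrs !size_map size_cat /=; lia.
have node_q := node_ptrs (size qs1); rewrite -sz_ptrs in node_q.
have {node_q} := node_q lt_q.
rewrite (nth_map (0, [::])) ?size_map ?size_cat /=; last by lia.
rewrite (nth_map [::]) ?size_cat /=; last by lia.
rewrite nth_cat ltnn subnn /= => node_q.
have lt_top : p + 3 + size ptrs <= 2 ^ W.
  by apply: leq_trans size_m; move: le_m; rewrite /=; lia.
have m0 : nth 0 m p = 1 by rewrite -[p]addn0 nth_ptrs.
have m1 : nth 0 m (p + 1) = word_of A by rewrite nth_ptrs.
have m2 : nth 0 m (p + 2) = word_of X by rewrite nth_ptrs.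
have ev_p s' c : reg s' 0 = p -> 0 < c < 3 -> eval W m s' (Op OAdd (Reg 0) (Const c)) = p + c.
  move=> s'0 c_lt; apply: eval_add => //; last by lia.
  by apply/eval_const/small; lia.
have one : 1 < 2 ^ W by apply: small.
have sub_ok : o * f ^ k <= i - 1 by rewrite -leq_divRL // subn1; lia.
(* One iteration costs 2 for the guard, 52 for the body and 1 for the loop, within the 60 allotted
   per level. *)
apply: (@runs_le _ _ _ _ (2 + 52 + 60 * (k - y).+1).+1); first by rewrite subSn // ; lia.
apply: runs_whileS; first by rewrite /= s0 m0.
apply: (@runs_le _ _ _ _ (6 + (4 + (4 + (13 + (8 + 12).+1).+1).+1).+1).+1) => //.
apply: runs_seq; apply: (runs_write (v1 := d) (v2 := word_of A)).
- exact: s5.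
- by rewrite (eval_data (ev_p _ _ s0 _)) ?m1.
apply: runs_seq; apply: (runs_assign (v := d + 1)).
  by apply: eval_add; [exact: s5|exact: eval_const|lia].
apply: runs_seq; apply: (runs_assign (v := f ^ k)).
  have -> : f ^ k = f ^ k.+1 %/ f by rewrite expnS mulKn //; lia.
  by apply: (@eval_op W m _ ODiv); [exact: s2|exact: s3].
apply: runs_seq; apply: (runs_assign (v := o + 1)).
  rewrite -pred_X -(pred1_word_of _ le_XW) -m2.
  apply: (@eval_op W m _ OPred); first by apply/eval_data/ev_p.
  apply: eval_add; [|exact: eval_const|].
    apply: (@eval_op W m _ ODiv); last by [].
    by apply: eval_sub; [exact: s1|exact: eval_const|lia].
  by have := leq_div (i - 1) (f ^ k); lia.
apply: runs_seq; apply: (runs_assign (v := i - o * f ^ k)).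
  apply: eval_sub; first exact: s1; last by lia.
  apply: eval_mul; [|by []|lia].
  rewrite -[o in RHS](addnK 1); apply: eval_sub; [by []|exact: eval_const|].
  by have := leq_mul (leqnn o) len_gt0; lia.
apply: (runs_assign (v := nth 0 ptrs (size qs1))).
  (* Three header cells and a 1-based rank: the pointer of rank [r] is at [p + 2 + r]. *)
  have -> : nth 0 ptrs (size qs1) = nth 0 m (p + 2 + (size qs1).+1).
    by rewrite -addnA add2n nth_ptrs.
  apply: eval_data; apply: eval_add; [exact: ev_p| |lia].
  rewrite -rank_X -(rank1_word_of _ le_XW) -m2.
  by apply: (@eval_op W m _ ORank); first exact/eval_data/ev_p.
set s' := State _ _.
have q_ok : over_alphabet (count id A) (flatten q).
  by apply/allP => c /q_h; apply: (allP (over_compact g_ok)).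
have le_countW : count id A <= W.
  by apply: leq_trans (count_size _ _) _; rewrite size_alphabet_bits.
(* The stack base of the child is [d.+1], since cell [d] now holds [A]. *)
have := IH _ _ _ (i - o * f ^ k) d.+1 s' le_countW q_ok q_size node_q.
case=> //; try lia.
- by rewrite /s' /= /update /= addn1.
move=> s'' [t' [ex le_t' [As [B [E [i' [H1 [Di' i'_ok] [As_ok le_As] [s''5 push keep] sel]]]]]]].
exists s'', t'; split=> //; exists (A :: As), B, E, i'; split=> //.
- by split=> //; lia.
- by rewrite /= size_alphabet_bits le_sigma subSn // ltnS.
- split; first by rewrite s''5 /= addSnnS.
    case=> [|j] /= lt_j; last by rewrite -addSnnS push.
    (* Cell [d] is below the child's stack base, so [keep] guarantees that deeper levels left it
       intact. *)
    by rewrite addn0 keep // /s' /= /update eqxx.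
  by move=> j lt_j; rewrite keep ?ltnS 1?ltnW // /s' /= /update ltn_eqF.
rewrite /= sel -(select1_compact g_ok i_ok); congr select1.
by rewrite /at1 -nth_q; congr nth; lia.
Qed.

End Loops.

(** * Top-level blocks and the whole query *)

Lemma size_bwt S : size (bwt S) = size S.
Proof. by rewrite size_map size_sort size_map size_iota. Qed.

(** Carries the alphabet bound of [S] over to its transform. Rotations of a nonempty string are
    nonempty, so the default 0 of [last] never appears. *)
Lemma bwt_sub S : {subset bwt S <= S}.
Proof.
move=> _ /mapP[r + ->]; rewrite mem_sort => /mapP[k].
rewrite mem_iota add0n => /andP[_ lt_k] ->.
have : size (rot k S) = size S by apply: size_rot.
case D: (rot k S) => [|c r'] sz; first by rewrite -sz in lt_k.
by rewrite -(mem_rot k) D; apply: mem_last.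
Qed.

Definition group_entries (F : seq nat -> vlb_node) (p : nat * seq nat) : seq root_entry :=
  Child (F p.2) :: [seq Offset d | d <- iota 1 p.1.-1].

(** Groups are nonempty, so each yields one child entry and one offset per further block: block
    numbers index the table. *)
Lemma size_group_entries w F qs : all (mergeable w) qs ->
  size (flatten [seq group_entries F p | p <- [seq (size q, flatten q) | q <- qs]])
    = size (flatten qs).
Proof.
elim: qs => //= q qs IH /andP[/andP[q_gt0 _] /IH{}IH].
by rewrite !size_cat size_map size_iota IH; lia.
Qed.

Lemma nth_group_entries w F qs1 q qs2 b (o := size (flatten qs1)) :
  all (mergeable w) (qs1 ++ q :: qs2) -> o <= b < o + size q ->
  nth (Offset 0) (flatten [seq group_entries F p
     | p <- [seq (size q, flatten q) | q <- qs1 ++ q :: qs2]]) b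
  = if b == o then Child (F (flatten q)) else Offset (b - o).
Proof.
move=> qs_ok lim; rewrite !map_cat flatten_cat nth_cat.
rewrite (@size_group_entries w) -/o; last by move: qs_ok; rewrite all_cat => /andP[].
rewrite ifF /=; last by lia.
case: eqP => [->|]; first by rewrite subnn.
case Dd: (b - o) => [|d] neq_bo; first by lia.
by rewrite /= nth_cat size_map size_iota ifT ?(nth_map 0) ?size_iota ?nth_iota //; lia.
Qed.

Lemma nth_pair_cells es b : b < size es ->
  nth 0 (pair_cells es) (b + b) = (nth (0, 0) es b).1 /\
  nth 0 (pair_cells es) (b + b).+1 = (nth (0, 0) es b).2.
Proof.
elim: es b => [|e es IH] [|b] // lt_b; rewrite addnS addSn.
exact: IH.
Qed.

Lemma entry_at_child m e u : entry_at m e (Child u) -> e.1 = 1 /\ node_at m e.2 u.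
Proof. by move=> H; inversion H. Qed.

Lemma entry_at_offset m e d : entry_at m e (Offset d) -> e = (0, d).
Proof. by move=> H; inversion H. Qed.

Lemma find_top_block_runs W m f x w sigma L a i :
  64 <= W -> valid_memory W m -> 0 < f -> over_alphabet sigma L ->
  tree_at m a (build_vlb_tree f x w sigma L) -> 1 <= i <= size L -> i < 2 ^ W ->
  runs W m find_top_block (init_state a i) 58 (fun s => exists g,
    [/\ node_at m (reg s 0) (build_node f w x sigma g),
        over_alphabet sigma g /\ (w < nruns g -> size g <= f ^ x),
        1 <= reg s 1 <= minn i (size g),
        at1 g (reg s 1) = at1 L i
      & [/\ reg s 2 = f ^ x, reg s 3 = f & reg s 5 = 0]]).
Proof.
move=> W_ge m_ok f_gt0 L_ok [es /storedP[le_m nth_es] [sz_es entries]] i_ok lt_i.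
have small c : c < 64 -> c < 2 ^ W by apply: (@const_lt_word W).
have len_gt0 : 0 < f ^ x by rewrite expn_gt0 f_gt0.
have lt_iL : i.-1 < size L by lia.
have [qs1 [q [qs2 [o [[Do Dgs] qs_ok sz_qs o_ok [lt_iq nth_q q_size q_L]]]]]] :=
  groups_split w len_gt0 lt_iL.
rewrite -subn1 in o_ok lt_iq nth_q lt_iL.
set b := (i - 1) %/ f ^ x in o_ok.
have nth_top b' : o <= b' < o + size q -> b' < size es -> entry_at m (nth (0, 0) es b')
    (if b' == o then Child (build_node f w x sigma (flatten q)) else Offset (b' - o)).
  move=> b'_ok lt_b'; have := entries b' lt_b'.
  by rewrite /= Dgs (nth_group_entries (build_node f w x sigma) qs_ok) -Do.
have le_es : o + size q <= size es.
  rewrite sz_es /= Dgs (size_group_entries (build_node f w x sigma) qs_ok) Do.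
  by rewrite flatten_cat /= !size_cat; lia.
have m0 : nth 0 m a = f ^ x by rewrite -[a]addn0 nth_es.
have m1 : nth 0 m (a + 1) = f by rewrite nth_es.
have sz_m : a + 2 + (size es).*2 <= size m.
  by move: le_m; rewrite size_cat size_pair_cells /=; lia.
have le_mW : size m <= 2 ^ W by case/andP: m_ok.
have m_e b' : o <= b' < o + size q ->
    nth 0 m (a + 2 + (b' + b')) = (nth (0, 0) es b').1 /\
    nth 0 m (a + 2 + (b' + b') + 1) = (nth (0, 0) es b').2.
  move=> b'_ok; have lt_b' : b' < size es by lia.
  have [<- <-] := nth_pair_cells lt_b'.
  rewrite (_ : a + 2 + _ + 1 = a + (b' + b').+3); last by lia.
  rewrite (_ : a + 2 + _ = a + (b' + b').+2); last by lia.
  by split; rewrite nth_es //= size_pair_cells; lia.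
have ev_a s b' : reg s 0 = a -> reg s 4 = b' -> o <= b' < o + size q ->
    eval W m s entry_addr = a + 2 + (b' + b').
  move=> s0 s4 b'_ok; apply: eval_add; last by lia.
    by apply: eval_add; [exact: s0|exact/eval_const/small|lia].
  by apply: eval_add; [exact: s4|exact: s4|lia].
have ev_a1 s b' : reg s 0 = a -> reg s 4 = b' -> o <= b' < o + size q ->
    eval W m s (DataAt (Op OAdd entry_addr (Const 1))) = (nth (0, 0) es b').2.
  move=> s0 s4 b'_ok; case: (m_e _ b'_ok) => _ <-; apply: eval_data; apply: eval_add.
  - exact: ev_a.
  - exact/eval_const/small.
  - by lia.
apply: (@runs_le _ _ _ _ (3 + (5 + (6 + (22 + (11 + 6).+1).+1).+1).+1).+1) => //.
apply: runs_seq; apply: (runs_assign (v := f ^ x)); first exact: m0.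
apply: runs_seq; apply: (runs_assign (v := f)).
  by rewrite -m1; apply/eval_data/eval_add => //; [exact/eval_const/small | lia].
apply: runs_seq; apply: (runs_assign (v := b)).
  apply: (@eval_op W m _ ODiv); last by [].
  by apply: eval_sub; [by []|exact/eval_const/small|lia].
set Q := (X in runs _ _ _ _ _ X).
(* Both branches of the conditional end with register 4 equal to [o], the first block of the group;
   the remaining commands are treated once for both. *)
have find_child s : reg s 0 = a -> reg s 1 = i -> reg s 2 = f ^ x -> reg s 3 = f ->
    reg s 4 = o -> reg s 5 = 0 -> runs W m
    (Seq (Assign 0 (DataAt (Op OAdd entry_addr (Const 1))))
       (Assign 1 (Op OSub (Reg 1) (Op OMul (Reg 4) (Reg 2))))) s 18 Q.
  move=> s0 s1 s2 s3 s4 s5.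
  have o_in : o <= o < o + size q by lia.
  have lt_o : o < size es by lia.
  have := nth_top o o_in lt_o; rewrite eqxx => /entry_at_child[_ node_q].
  have sub_ok : o * f ^ x <= i - 1 by rewrite -leq_divRL //; lia.
  apply: (@runs_le _ _ _ _ (11 + 6).+1) => //; apply: runs_seq.
  apply: (runs_assign (v := (nth (0, 0) es o).2)); first exact: ev_a1.
  apply: (runs_assign (v := i - o * f ^ x)).
    by apply: eval_sub; [exact: s1 | apply: eval_mul; [exact: s4|exact: s2|lia] | lia].
  exists (flatten q); split=> //.
  - by split=> //; apply/allP => c /q_L; apply: (allP L_ok).
  - by rewrite /= /update /=; lia.
  - by rewrite /at1 -[i.-1]subn1 -nth_q; congr nth; rewrite /= /update /=; lia.
apply: runs_seq; apply: (@runs_le _ _ _ _ (8 + 13).+1) => //; apply: runs_if.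
rewrite (eval_data (ev_a _ b _ _ o_ok)) //; case: (m_e _ o_ok) => -> _.
have lt_b : b < size es by lia.
(* Entry [b] is a child exactly when [b = o]; otherwise its stored distance [b - o] leads back to
   [o]. *)
have := nth_top b o_ok lt_b; case: eqP => [Db|neq_bo].
  case/entry_at_child=> -> _; apply: (@runs_le _ _ _ _ 1) => //.
  by apply: runs_skip; apply: find_child => //; rewrite Db.
move/entry_at_offset=> De; rewrite De /=.
apply: (runs_assign (v := o)).
  have -> : o = b - (b - o) by lia.
  apply: eval_sub; [by [] | by rewrite (ev_a1 _ b _ _ o_ok) // De | lia].
exact: find_child.
Qed.

Lemma access_correct (W n sigma f x y l w : nat) (S : seq nat) (m : seq nat) (a i : nat) :
  1 < f -> f <= 64 -> 64 <= W -> sigma <= W -> n < 2 ^ W ->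
  y < x -> l = f ^ x -> w = f ^ y ->
  size S = n -> all (fun c => 1 <= c <= sigma) S ->
  valid_memory W m ->
  tree_at m a (build_vlb_tree f x w sigma (bwt S)) ->
  1 <= i <= n ->
  runs W m access_program (init_state a i) (400 * (trunc_log f (l %/ w) + w))
    (fun s => answer s = at1 (bwt S) i).
Proof.
move=> f_gt1 f_le W_ge le_sigma lt_n lt_yx -> Dw szS S_ok m_ok T_at i_ok.
have -> : trunc_log f (f ^ x %/ w) = x - y.
  by rewrite Dw -expnB ?trunc_expnK //; lia.
have L_ok : over_alphabet sigma (bwt S).
  by apply/allP => c /bwt_sub; apply: (allP S_ok).
have w_gt0 : 0 < w by rewrite Dw expn_gt0; lia.
(* The summands are the top-level lookup, the descent, the push at the leaf, the scan, the reading
   of the symbol and the ascent. Since [x - y] and [w] are positive, 400 absorbs the constants. *)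
apply: (@runs_le _ _ _ _ (58 + (60 * (x - y).+1 +
  (16 + (20 * w.+1 + (3 + 20 * (x - y).+2).+1).+1).+1).+1).+1); first by lia.
apply: runs_seq.
(* The stack height is at most [x - y + 1]. It fits in a word because [x < f ^ x] and the cell at
   [a] stores [f ^ x]. *)
have lt_x : x.+1 < 2 ^ W.
  apply: (@leq_ltn_trans (f ^ x)); first exact: ltn_expl.
  case: T_at => es /storedP[_ /(_ 0 isT)] /= <- _.
  case: (ltnP (a + 0) (size m)) => [lt_m|le_m]; last by rewrite nth_default // expn_gt0.
  by case/andP: m_ok => _ /(all_nthP 0)/(_ _ lt_m).
have i_okL : 1 <= i <= size (bwt S) by rewrite size_bwt szS.
have lt_iW : i < 2 ^ W by lia.
have [|s1 [t1 [ex1 le_t1 [g [node_g [g_ok g_size] i1_ok at_g [s1_2 s1_3 s1_5]]]]]] :=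
  find_top_block_runs W_ge m_ok _ L_ok T_at i_okL lt_iW; first by lia.
exists s1, t1; split=> //; apply: runs_seq; rewrite Dw in node_g g_size.
have [||||s2 [t2 [ex2 le_t2 [As [A [E [i' [[stE szE] [Di' i'_ok] [As_ok szAs] [s2_5 push _] sel]]]]]]]] :=
  @descend_runs W m W_ge m_ok f y x sigma g _ (reg s1 1) 0 s1 _ le_sigma g_ok g_size node_g
     _ _ _ erefl erefl s1_2 s1_3 s1_5; try lia.
rewrite at_g in sel; exists s2, t2; split=> //.
case/storedP: stE => le_m nth_E.
have le_mW : size m <= 2 ^ W by case/andP: m_ok.
(* A valid position forces a run, so the address three cells after the start of the leaf lies in
   memory and does not wrap. *)
have E_gt0 : 0 < size E by case: E i'_ok {sel szE nth_E le_m} => //=; lia.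
have {}le_m : reg s2 0 + 3 + size (pair_cells E) <= size m by move: le_m => /=; lia.
rewrite add0n in s2_5.
have small c : c < 64 -> c < 2 ^ W by apply: const_lt_word.
apply: runs_seq; apply: (@runs_le _ _ _ _ (6 + (4 + 4).+1).+1) => //.
apply: runs_seq; apply: (runs_write (v1 := size As) (v2 := word_of A)).
- exact: s2_5.
- have <- : nth 0 m (reg s2 0 + 1) = word_of A by rewrite nth_E.
  apply/eval_data/eval_add; [by []|exact/eval_const/small|].
  by lia.
apply: runs_seq; apply: (runs_assign (v := size As + 1)).
  by apply: eval_add; [exact: s2_5|exact/eval_const/small|lia].
apply: (runs_assign (v := reg s2 0 + 3)).
  apply: eval_add; [by []|exact/eval_const/small|].
  by move: le_m; rewrite size_pair_cells; lia.
set s3 := State _ _; apply: runs_seq.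
have [|||s4 [t4 [ex4 le_t4 [Q1 Q2 Q3]]]] :=
  @scan_runs W m W_ge m_ok E (reg s2 0 + 3) i' s3 _ _ _ erefl Di'.
- apply/storedP; split=> // j lt_j; rewrite -addnA nth_E //.
- by lia.
- by lia.
exists s4, t4; split=> //; first by lia.
apply: runs_seq; apply: (@runs_le _ _ _ _ 3) => //.
apply: (runs_assign (v := at1 (unrle E) i')); first exact: Q1.
set s5 := State _ _.
have [|||s6 [t6 [ex6 le_t6 Q6]]] := @ascend_runs W m W_ge m_ok (rcons As A) (at1 (unrle E) i') s5 As_ok _ _ erefl _.
- by rewrite size_rcons; apply: leq_ltn_trans lt_x; apply: leq_trans szAs (leq_subr _ _).
(* Cell [size As] was written at the leaf, the lower ones during the descent. *)
- move=> j; rewrite size_rcons ltnS /s5 /= Q3 /s3 /= /update nth_rcons => le_j.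
  by case: ltngtP le_j => // lt_j _; apply: push.
- by rewrite /s5 /= /update /= Q2 /s3 /= /update /= size_rcons addn1.
exists s6, t6; split=> //; last by rewrite Q6.
by apply: leq_trans le_t6 _; rewrite size_rcons leq_mul2l !ltnS szAs.
Qed.

(* One program and one constant serve all strings, parameters, word sizes and
   memory layouts.  [l %/ w] is a power of f, so [trunc_log] is its exact
   base-f logarithm. *)
Theorem theorem3p2 :
  exists (access : cmd) (C : nat),
  forall (W n sigma f x y l w : nat) (S : seq nat) (m : seq nat) (a : nat),
    1 < f -> f <= 64 -> 64 <= W ->
    sigma <= W -> n < 2 ^ W ->
    y < x -> l = f ^ x -> w = f ^ y ->
    size S = n -> all (fun c => 1 <= c <= sigma) S ->
    valid_memory W m ->
    tree_at m a (build_vlb_tree f x w sigma (bwt S)) ->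
    forall i : nat, 1 <= i <= n ->
      exists (s : state) (t : nat),
        [/\ exec W m access (init_state a i) s t,
            answer s = at1 (bwt S) i
          & t <= C * (trunc_log f (l %/ w) + w)].
Proof.
exists access_program, 400 => W n sigma f x y l w S m a f_gt1 f_le W_ge le_sigma.
move=> lt_n lt_yx Dl Dw szS S_ok m_ok T_at i i_ok.
have [s [t [ex le_t ans]]] := access_correct f_gt1 f_le W_ge le_sigma lt_n lt_yx
  Dl Dw szS S_ok m_ok T_at i_ok.
by exists s, t.
Qed.
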